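(* Let $n,r$ be integers with $0\le r\le\lfloor n/2\rfloor-1$. The Pfaffian variety $\mathbf{C}(n,2r)$ is a minimal singular surface in $Skew(n,\mathbf{R})$ under the natural inclusion; that is, the submanifold of its regular points has vanishing mean curvature in $Skew(n,\mathbf{R})$.
   Context: $Skew(n,\mathbf{R})\cong\mathbf{R}^{n(n-1)/2}$ is the space of real $n\times n$ skew-symmetric matrices with the Euclidean norm $|M|^2=\frac12\operatorname{tr}(MM^T)$. The Pfaffian variety is $\mathbf{C}(n,2r)=\{X\in Skew(n,\mathbf{R}):\operatorname{rank}X\le 2r\}$. Its regular points are the matrices of rank exactly $2r$, which form a smooth submanifold of $Skew(n,\mathbf{R})$. *)

(* Defs.v *)
From HB Require Import structures.
From mathcomp Require Import all_boot all_order all_algebra.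
From mathcomp Require Import sesquilinear.
From mathcomp Require Import all_classical all_reals all_analysis.

Set Implicit Arguments.
Unset Strict Implicit.
Unset Printing Implicit Defensive.

Import Order.TTheory GRing.Theory Num.Theory.
Import numFieldNormedType.Exports.

Local Open Scope classical_set_scope.
Local Open Scope ring_scope.

Section Submanifolds.
Context {R : realType} {V : normedModType R} (k : nat).
Implicit Types (U : set 'rV[R]_k) (phi : 'rV[R]_k -> V) (u : 'rV[R]_k).

Definition pderiv (i : 'I_k) phi : 'rV[R]_k -> V :=
  fun u => 'D_(delta_mx 0 i) phi u.

(* Meant for open U only: the derivatives are taken in the whole of R^k. *)
Fixpoint Cm_on (m : nat) U phi : Prop :=
  if m is m'.+1 then
    [/\ {in U, continuous phi},
        forall (i : 'I_k) u, U u -> derivable phi u (delta_mx 0 i)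
      & forall i : 'I_k, Cm_on m' U (pderiv i phi)]
  else {in U, continuous phi}.

Definition smooth_on U phi : Prop := forall m, Cm_on m U phi.

Definition immersion_on U phi : Prop :=
  forall u, U u -> forall c : 'I_k -> R,
    \sum_i c i *: pderiv i phi u = 0 -> forall i, c i = 0.

(* phi is a diffeomorphism from the open set U of R^k onto the relatively open
   subset M `&` W of M; the continuous inverse psi rules out
   self-accumulation, so that M is embedded. *)
Definition local_parametrization (M : set V) U phi : Prop :=
  [/\ open U, smooth_on U phi, immersion_on U phi
    & exists (W : set V) (psi : V -> 'rV[R]_k),
        [/\ open W, phi @` U = M `&` W,
            {within M `&` W, continuous psi}
          & forall u, U u -> psi (phi u) = u]].

(* Meant for a linear subspace E of V. As M is included in E, the open subsets
   of V and those of E induce the same topology on M. *)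
Definition smooth_submanifold (E M : set V) : Prop :=
  M `<=` E /\
  forall p, M p -> exists U phi, local_parametrization M U phi /\ (phi @` U) p.

Variable dot : V -> V -> R.

Definition first_fundamental_form phi u : 'M[R]_k :=
  \matrix_(i, j) dot (pderiv i phi u) (pderiv j phi u).

(* Orthogonal projection of w onto the span of the partial derivatives:
   \sum_(i, j) g^(ij) <w, d_j phi> d_i phi. *)
Definition tangent_component phi u (w : V) : V :=
  \sum_i \sum_j (invmx (first_fundamental_form phi u) i j
                 * dot w (pderiv j phi u)) *: pderiv i phi u.

Definition normal_component phi u (w : V) : V := w - tangent_component phi u w.

(* II(d_i phi, d_j phi), the normal part of the flat derivative. When phi maps
   U into a linear subspace E, its derivatives are in E as well, so that this
   is the second fundamental form of the image as a submanifold of E. *)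
Definition second_fundamental_form phi u (i j : 'I_k) : V :=
  normal_component phi u (pderiv i (pderiv j phi) u).

(* The trace of the second fundamental form with respect to the induced metric,
   without the factor 1 / k that some authors include. *)
Definition mean_curvature phi u : V :=
  \sum_i \sum_j invmx (first_fundamental_form phi u) i j
                *: second_fundamental_form phi u i j.

End Submanifolds.

Definition minimal_submanifold (R : realType) (V : normedModType R)
    (dot : V -> V -> R) (E M : set V) : Prop :=
  exists k : nat,
    smooth_submanifold k E M /\
    forall (U : set 'rV[R]_k) (phi : 'rV[R]_k -> V),
      local_parametrization M U phi ->
      forall u, U u -> mean_curvature dot phi u = 0.

Section Pfaffian.
Context {R : realType}.

Definition Skew (n : nat) : set 'M[R]_n := [set X | X \is skewmx].

(* The inner product of the norm |X|^2 = tr(X X^T) / 2. *)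
Definition skew_dot (n : nat) (X Y : 'M[R]_n) : R := 2^-1 * \tr (X *m Y^T).

(* C(n, 2r) *)
Definition pfaffian_variety (n r : nat) : set 'M[R]_n :=
  [set X | Skew X /\ (\rank X <= 2 * r)%N].

Definition pfaffian_regular (n r : nat) : set 'M[R]_n :=
  [set X | pfaffian_variety r X /\ \rank X = (2 * r)%N].

End Pfaffian.

Arguments Skew : clear implicits.
Arguments pfaffian_variety : clear implicits.
Arguments pfaffian_regular : clear implicits.

(* Main.v *)
From HB Require Import structures.
Require Import Defs.
From mathcomp Require Import all_boot all_order all_algebra.
From mathcomp Require Import sesquilinear.
From mathcomp Require Import all_classical all_reals all_analysis.
Import numFieldNormedType.Exports.

Set Implicit Arguments.
Unset Strict Implicit.
Unset Printing Implicit Defensive.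

Import Order.TTheory GRing.Theory Num.Theory.

Local Open Scope classical_set_scope.
Local Open Scope ring_scope.

(* Let X have rank m = 2r, let the rows of K span its kernel and those of H its
   row space, and let G = H^T (H X H^T)^-1 H, a skew matrix. Nearby skew
   matrices of rank m are determined by their compressions to (H, H) and (K, H),
   which gives a polynomial chart; the tangent space consists of the skew Z with
   K Z K^T = 0, and the normal part of W is read off K W K^T. Differentiating
   the vanishing Schur complement twice gives
     K d_i d_j X K^T = K (Z_i G Z_j + Z_j G Z_i) K^T.
   The metric trace of Z G Z over the tangent space only involves G^T, which K
   kills, and the diagonal of G, which is zero. *)

(** * Limits of matrix-valued maps *)

Section MatrixLimits.
Context {R : realType} {T : Type} {F : set_system T} {FF : Filter F}.

Lemma cvg_mx a b (f : T -> 'M[R]_(a, b)) (l : 'M[R]_(a, b)) :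
  (forall i j, f t i j @[t --> F] --> l i j) -> f @ F --> l.
Proof.
move=> fl A [P Pl PA]; rewrite /nbhs /=.
have : \forall t \near F, forall ij : 'I_a * 'I_b, P ij.1 ij.2 (f t ij.1 ij.2).
  by apply: filter_forall => ij; apply: fl; apply: Pl.
by apply: filterS => t Pt; apply: PA => i j; exact: (Pt (i, j)).
Qed.

Lemma cvg_coord_mx a b (f : T -> 'M[R]_(a, b))
    (l : 'M[R]_(a, b)) i j :
  f @ F --> l -> f t i j @[t --> F] --> l i j.
Proof.
by move=> fl; apply: (continuous_cvg _ (@coord_continuous _ _ _ i j l) fl).
Qed.

Lemma cvg_sumr (I : Type) (r : seq I) (P : pred I) (W : normedModType R)
    (f : I -> T -> W) (l : I -> W) :
  (forall i, P i -> f i @ F --> l i) ->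
  \sum_(i <- r | P i) f i t @[t --> F] --> \sum_(i <- r | P i) l i.
Proof. by move=> fl; apply: cvg_big => //; exact: add_continuous. Qed.

Lemma cvg_prodr (I : Type) (r : seq I) (P : pred I)
    (f : I -> T -> R) (l : I -> R) :
  (forall i, P i -> f i @ F --> l i) ->
  \prod_(i <- r | P i) f i t @[t --> F] --> \prod_(i <- r | P i) l i.
Proof. by move=> fl; apply: cvg_big => //; exact: mul_continuous. Qed.

Lemma cvg_mulmx a b c (f : T -> 'M[R]_(a, b)) (g : T -> 'M[R]_(b, c))
    (l : 'M[R]_(a, b)) (m : 'M[R]_(b, c)) :
  f @ F --> l -> g @ F --> m -> f t *m g t @[t --> F] --> l *m m.
Proof.
move=> fl gm; apply: cvg_mx => i j; rewrite mxE.
under eq_fun do rewrite mxE.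
by apply: cvg_sumr => k _; apply: cvgM; exact: cvg_coord_mx.
Qed.

(** Expanding the argument in matrix units writes [L] as a finite sum of entries times fixed
    vectors. *)
Lemma cvg_linear_mx a b (W : normedModType R) (L : {linear 'M[R]_(a, b) -> W})
    (f : T -> 'M[R]_(a, b)) (l : 'M[R]_(a, b)) :
  f @ F --> l -> L (f t) @[t --> F] --> L l.
Proof.
move=> fl.
have LE A : L A = \sum_i \sum_j A i j *: L (delta_mx i j).
  rewrite [in LHS](matrix_sum_delta A) linear_sum; apply: eq_bigr => i _.
  by rewrite linear_sum; apply: eq_bigr => j _; rewrite linearZ.
rewrite LE; under eq_fun do rewrite LE.
apply: cvg_sumr => i _; apply: cvg_sumr => j _.
by apply: cvgZr_tmp; exact: cvg_coord_mx.
Qed.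

Lemma cvg_det a (f : T -> 'M[R]_a) (l : 'M[R]_a) :
  f @ F --> l -> \det (f t) @[t --> F] --> \det l.
Proof.
move=> fl; apply: cvg_sumr => s _; apply: cvgM; first exact: cvg_cst.
by apply: cvg_prodr => i _; exact: cvg_coord_mx.
Qed.

Lemma near_unitmx a (f : T -> 'M[R]_a) (l : 'M[R]_a) :
  l \in unitmx -> f @ F --> l -> \forall t \near F, f t \in unitmx.
Proof.
move=> lu fl; have := cvg_det fl.
have dl : \det l != 0 by rewrite -unitfE -unitmxE.
move=> /(_ [set x | x != 0]) h.
have : \forall t \near F, \det (f t) != 0 by apply: h; exact: open_nbhs_nbhs.
by apply: filterS => t dt; rewrite unitmxE unitfE.
Qed.

(** By the cofactor formula the inverse is rational in the entries. As [invmx] is defined by cases,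
    the formula is used only where [f t] is invertible, which holds eventually along [F]. *)
Lemma cvg_invmx a (f : T -> 'M[R]_a) (l : 'M[R]_a) :
  l \in unitmx -> f @ F --> l -> invmx (f t) @[t --> F] --> invmx l.
Proof.
move=> lu fl.
have dl : \det l != 0 by rewrite -unitfE -unitmxE.
have adjl : \adj (f t) @[t --> F] --> \adj l.
  apply: cvg_mx => i j; rewrite mxE; under eq_fun do rewrite mxE.
  rewrite /cofactor; apply: cvgM; first exact: cvg_cst.
  apply: cvg_det; apply: cvg_mx => i' j'; rewrite !mxE.
  by under eq_fun do rewrite !mxE; exact: cvg_coord_mx.
rewrite /invmx lu.
have : (\det (f t))^-1 *: \adj (f t) @[t --> F] --> (\det l)^-1 *: \adj l.
  by apply: cvgZ => //; apply: cvgV => //; exact: cvg_det.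
apply: cvg_trans; apply: near_eq_cvg.
by apply: filterS (near_unitmx lu fl) => t /= ->.
Qed.

End MatrixLimits.

(** * Directional derivatives of matrix-valued maps *)

Section MatrixDerivatives.
Context {R : realType} {V : normedModType R}.
Implicit Types x v : V.

Lemma is_derive_quotientP (W : normedModType R) (f : V -> W) x v df :
  is_derive x v f df <->
  h^-1 *: (f (h *: v + x) - f x) @[h --> 0^'] --> df.
Proof.
split=> [[fx <-] //|fl]; split; first by apply/cvg_ex; exists df.
exact: (cvg_lim _ fl).
Qed.

(** The tool that turns an identity valid near [x] into an identity between derivatives: both sides
    are differentiated separately and compared. *)
Lemma is_derive_near_unique (W : normedModType R) (f g : V -> W) x v a b :
  (\forall y \near x, f y = g y) ->
  is_derive x v f a -> is_derive x v g b -> a = b.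
Proof. by move=> fg [_ <-] [_ <-]; exact: near_eq_derive. Qed.

Lemma cvg_line x v : h *: v + x @[h --> (0 : R)^'] --> x.
Proof.
rewrite -[X in _ --> X]add0r -(scale0r v).
apply: cvgD; last exact: cvg_cst.
by apply: cvgZr_tmp; apply: cvg_trans (@cvg_within _ _ _ _) _.
Qed.

Lemma is_derive_cvg (W : normedModType R) (f : V -> W) x v df :
  is_derive x v f df -> f (h *: v + x) @[h --> 0^'] --> f x.
Proof.
move=> /is_derive_quotientP fl.
have idl : (h : R) @[h --> 0^'] --> (0 : R).
  by apply: cvg_trans (@cvg_within _ _ _ _) _.
have : h *: (h^-1 *: (f (h *: v + x) - f x)) + f x @[h --> 0^'] -->
    0 *: df + f x.
  by apply: cvgD; [exact: cvgZ|exact: cvg_cst].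
rewrite scale0r add0r; apply: cvg_trans; apply: near_eq_cvg.
near=> h; rewrite scalerA divff ?scale1r ?subrK //.
by near: h; exact: nbhs_dnbhs_neq.
Unshelve. all: by end_near. Qed.

Lemma is_derive_linear_mx a b (W : normedModType R)
    (L : {linear 'M[R]_(a, b) -> W}) (f : V -> 'M[R]_(a, b)) x v
    (df : 'M[R]_(a, b)) :
  is_derive x v f df -> is_derive x v (L \o f) (L df).
Proof.
move=> /is_derive_quotientP fl; apply/is_derive_quotientP.
under eq_fun do rewrite /= -linearB -linearZ.
exact: cvg_linear_mx.
Qed.

(** As [f] vanishes at [x], the difference quotient of the product is that of [f] times [g], so [g]
    needs a limit along the line but no derivative. Factors containing inverse matrices can thus be
    handled by continuity alone. *)
Lemma is_derive_mulmx0l a b c (f : V -> 'M[R]_(a, b)) (g : V -> 'M[R]_(b, c))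
    x v (df : 'M[R]_(a, b)) (gx : 'M[R]_(b, c)) :
  f x = 0 -> is_derive x v f df -> g (h *: v + x) @[h --> 0^'] --> gx ->
  is_derive x v (fun y => f y *m g y) (df *m gx).
Proof.
move=> fx0 /is_derive_quotientP fl gl; apply/is_derive_quotientP.
rewrite fx0 in fl *; under eq_fun do rewrite mul0mx subr0 scalemxAl.
by under eq_fun do rewrite -[X in _ *: X]subr0; exact: cvg_mulmx.
Qed.

Lemma is_derive_mulmx a b c (f : V -> 'M[R]_(a, b)) (g : V -> 'M[R]_(b, c))
    x v (df : 'M[R]_(a, b)) (dg : 'M[R]_(b, c)) :
  is_derive x v f df -> is_derive x v g dg ->
  is_derive x v (fun y => f y *m g y) (df *m g x + f x *m dg).
Proof.
move=> fl gl.
(* Subtracting the constant [f x] leaves a product whose left factor vanishes at [x], plus a linear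
   image of [g]. *)
have -> : (fun y => f y *m g y) =
    (fun y => (f y - f x) *m g y) + (mulmx (f x) \o g).
  by apply/funext => y; rewrite /= !fctE mulmxBl subrK.
apply: is_deriveD.
  apply: is_derive_mulmx0l; [exact: subrr| |exact: is_derive_cvg gl].
  have -> : (fun y => f y - f x) = f - cst (f x) by [].
  by rewrite -[df]subr0; apply: is_deriveB.
exact: is_derive_linear_mx.
Qed.

End MatrixDerivatives.

(** * Polynomial matrix maps and their smoothness *)

Section SmoothPolynomialMaps.
Context {R : realType} {k : nat}.

(** A class closed under directional derivatives, so that smoothness follows by induction on the
    order. The sizes are indices because products change the shape. *)
Inductive mxpoly_map : forall a b, ('rV[R]_k -> 'M[R]_(a, b)) -> Prop :=
| mxpoly_cst a b (M : 'M[R]_(a, b)) : mxpoly_map (cst M)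
| mxpoly_linear a b (L : {linear 'rV[R]_k -> 'M[R]_(a, b)}) : mxpoly_map L
| mxpoly_add a b (f g : 'rV[R]_k -> 'M[R]_(a, b)) :
    mxpoly_map f -> mxpoly_map g -> mxpoly_map (f + g)
| mxpoly_mul a b c (f : 'rV[R]_k -> 'M[R]_(a, b))
    (g : 'rV[R]_k -> 'M[R]_(b, c)) :
    mxpoly_map f -> mxpoly_map g -> mxpoly_map (fun u => f u *m g u).

Lemma mxpoly_map_continuous a b (f : 'rV[R]_k -> 'M[R]_(a, b)) :
  mxpoly_map f -> continuous f.
Proof.
elim=> {a b f} [a b M|a b L|a b f g _ fc _ gc|a b c f g _ fc _ gc] u.
- exact: cst_continuous.
- exact: (cvg_linear_mx (L := L) (@cvg_id _ (nbhs u))).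
- exact: (cvgD (fc u) (gc u)).
- exact: (cvg_mulmx (fc u) (gc u)).
Qed.

Lemma mxpoly_map_derive a b (f : 'rV[R]_k -> 'M[R]_(a, b)) v :
  mxpoly_map f ->
  exists2 df, mxpoly_map df & forall u, is_derive u v f (df u).
Proof.
elim=> {a b f} [a b M|a b L|a b f g _ [df dfp fE] _ [dg dgp gE]|
    a b c f g fp [df dfp fE] gp [dg dgp gE]].
- exists (cst 0); first exact: mxpoly_cst.
  by move=> u; exact: is_derive_cst.
- exists (cst (L v)); first exact: mxpoly_cst.
  by move=> u; apply: (is_derive_linear_mx L (is_derive_id u v)).
- exists (df + dg); first exact: mxpoly_add.
  by move=> u; apply: is_deriveD.
- exists ((fun u => df u *m g u) + (fun u => f u *m dg u)).
    by apply: mxpoly_add; exact: mxpoly_mul.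
  by move=> u; apply: is_derive_mulmx.
Qed.

Lemma mxpoly_map_smooth a b (f : 'rV[R]_k -> 'M[R]_(a, b)) U :
  mxpoly_map f -> smooth_on U f.
Proof.
move=> + m; elim: m f => [|m IH] f fp /=.
  by move=> u _; exact: mxpoly_map_continuous.
split; first by move=> u _; exact: mxpoly_map_continuous.
  by move=> i u _; have [df _ /(_ u)[]] := mxpoly_map_derive (delta_mx 0 i) fp.
move=> i; have [df dfp dfE] := mxpoly_map_derive (delta_mx 0 i) fp.
have -> : pderiv i f = df by apply/funext => u; have [_ <-] := dfE u.
exact: IH.
Qed.

End SmoothPolynomialMaps.

(** * Block conjugation, rank and Schur complements *)

Lemma skewmxE (R : fieldType) n (X : 'M[R]_n) :
  (X \is skewmx) = (X^T == - X).
Proof.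
by rewrite is_hermitianmxE expr1 scaleN1r map_mx_id // -eqr_oppLR eq_sym.
Qed.

Lemma mulmx_delta (R : comNzRingType) a b c d (G : 'M[R]_(b, c)) i j k l :
  delta_mx i j *m G *m delta_mx k l = G j k *: delta_mx i l :> 'M[R]_(a, d).
Proof.
rewrite -(mul_delta_mx (0 : 'I_1)) -(mul_delta_mx (0 : 'I_1) k l).
rewrite -!mulmxA (mulmxA G) -colE (mulmxA (delta_mx 0 j)) -rowE.
rewrite [row _ _]mx11_scalar !mxE mul_scalar_mx -scalemxAr.
by rewrite mul_delta_mx.
Qed.

Lemma conj_col_mx (R : comNzRingType) m q n (H : 'M[R]_(m, n))
    (K : 'M[R]_(q, n)) (X : 'M[R]_n) :
  col_mx H K *m X *m (col_mx H K)^T =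
  block_mx (H *m X *m H^T) (H *m X *m K^T) (K *m X *m H^T) (K *m X *m K^T).
Proof. by rewrite tr_col_mx mul_col_mx mul_col_row. Qed.

Lemma mxrank_conj_unit (R : fieldType) n (P X : 'M[R]_n) :
  P \in unitmx -> \rank (P *m X *m P^T) = \rank X.
Proof.
move=> Pu; rewrite mxrankMfree ?row_free_unit ?unitmx_tr //.
rewrite -mxrank_tr trmx_mul mxrankMfree ?row_free_unit ?unitmx_tr //.
by rewrite mxrank_tr.
Qed.

(** The rows of [[A B]] already have rank [m], that of the whole matrix, so [[C D] = T [A B]] for
    some [T]. The first block gives [T = C A^-1], the second gives [D]. *)
Lemma schur_complement_eq0 (R : fieldType) m q (A : 'M[R]_m) (B : 'M[R]_(m, q))
    (C : 'M[R]_(q, m)) (D : 'M[R]_q) :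
  A \in unitmx -> \rank (block_mx A B C D) = m ->
  D = C *m invmx A *m B.
Proof.
move=> Au rY.
have : (row_mx C D <= row_mx A B)%MS.
  apply: (submx_trans (B := block_mx A B C D)).
    by rewrite /block_mx -addsmxE addsmxSr.
  have sub : (row_mx A B <= block_mx A B C D)%MS.
    by rewrite /block_mx -addsmxE addsmxSl.
  rewrite -(geq_leqif (mxrank_leqif_sup sub)) rY.
  rewrite -{1}(mxrank_unit Au).
  have {1}-> : A = row_mx A B *m col_mx 1%:M 0.
    by rewrite mul_row_col mulmx1 mulmx0 addr0.
  exact: mxrankM_maxl.
case/submxP => T; rewrite mul_mx_row => /eq_row_mx[-> ->].
by rewrite mulmxK.
Qed.

(** * Kernel and row space of a skew matrix *)

Section SkewLinearAlgebra.
Context {R : realFieldType}.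

(** The diagonal entries of [A A^T] are sums of squares; this is where the ordering of the field
    enters. *)
Lemma mulmx_trmx_eq0 a b (A : 'M[R]_(a, b)) : A *m A^T = 0 -> A = 0.
Proof.
move=> AA; apply/matrixP => i j; rewrite !mxE.
have /matrixP/(_ i i) := AA; rewrite !mxE.
under eq_bigr do rewrite mxE -expr2.
move=> /psumr_eq0P h; apply/eqP; rewrite -sqrf_eq0; apply/eqP/h => //.
by move=> *; exact: sqr_ge0.
Qed.

Lemma unitmx_inj a (A : 'M[R]_a) :
  (forall v : 'rV[R]_a, v *m A = 0 -> v = 0) -> A \in unitmx.
Proof.
move=> inj; rewrite -row_free_unit -kermx_eq0; apply/eqP/row_matrixP => i.
by rewrite row0; apply: inj; rewrite -row_mul mulmx_ker row0.
Qed.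

Lemma row_free_gram_unitmx a b (A : 'M[R]_(a, b)) :
  row_free A -> A *m A^T \in unitmx.
Proof.
move=> Af; apply: unitmx_inj => v vA; apply: (row_free_inj Af).
rewrite mul0mx; apply: mulmx_trmx_eq0.
by rewrite trmx_mul mulmxA -[v *m _ *m _]mulmxA vA mul0mx.
Qed.

Lemma row_base_exists a b m (A : 'M[R]_(a, b)) : \rank A = m ->
  exists2 B : 'M[R]_(m, b), row_free B & (B :=: A)%MS.
Proof.
by move=> <-; exists (row_base A); [exact: row_base_free|exact: eq_row_base].
Qed.

Lemma skew_rank_splitting m q (p : 'M[R]_(m + q)) : p^T = - p -> \rank p = m ->
  exists (H : 'M[R]_(m, m + q)) (K : 'M[R]_(q, m + q)),
    [/\ K *m p = 0, H *m K^T = 0, H *m p *m H^T \in unitmx,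
        K *m K^T \in unitmx & col_mx H K \in unitmx].
Proof.
move=> pT rp.
have [H Hf Hp] := row_base_exists rp.
have [|K Kf Kp] := @row_base_exists _ _ q (kermx p).
  by rewrite mxrank_ker rp addKn.
have Kp0 : K *m p = 0 by apply/sub_kermxP; rewrite Kp.
have pK : p *m K^T = 0.
  by apply: trmx_inj; rewrite trmx_mul trmxK pT mulmxN Kp0 oppr0 trmx0.
have /submxP[B HB] : (H <= p)%MS by rewrite Hp.
have HK : H *m K^T = 0 by rewrite HB -mulmxA pK mulmx0.
have HHu := row_free_gram_unitmx Hf; have KKu := row_free_gram_unitmx Kf.
have KH : K *m H^T = 0 by apply: trmx_inj; rewrite trmx_mul trmxK HK trmx0.
have Pu : col_mx H K \in unitmx.
  apply: unitmx_inj => v; rewrite -[v]hsubmxK mul_row_col => vP.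
  have vl : lsubmx v = 0.
    apply: (can_inj (mulmxK HHu)); rewrite mul0mx mulmxA.
    move/(congr1 (mulmx^~ H^T)): vP.
    by rewrite mulmxDl -[rsubmx v *m _ *m _]mulmxA KH mulmx0 addr0 mul0mx.
  have vr : rsubmx v = 0.
    apply: (can_inj (mulmxK KKu)); rewrite mul0mx mulmxA.
    move/(congr1 (mulmx^~ K^T)): vP.
    by rewrite mulmxDl -[lsubmx v *m _ *m _]mulmxA HK mulmx0 add0r mul0mx.
  by rewrite vl vr row_mx0.
exists H, K; split=> //.
(* If [v] annihilates the compression, then [v H p] vanishes against the rows of both [H] and [K],
   so [v H] lies in the kernel as well as in the row space. *)
apply: unitmx_inj => v vA.
have vHp : v *m H *m p = 0.
  have : v *m H *m p *m (col_mx H K)^T = 0.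
    rewrite tr_col_mx mul_mx_row -!mulmxA pK !mulmx0.
    by rewrite [H *m _]mulmxA vA row_mx0.
  by move/(canRL (mulmxK _)) => ->; rewrite ?mul0mx ?unitmx_tr.
have /submxP[w vw] : (v *m H <= K)%MS by rewrite Kp; apply/sub_kermxP.
apply: (row_free_inj Hf); rewrite mul0mx vw.
suff -> : w = 0 by rewrite mul0mx.
apply: (can_inj (mulmxK KKu)).
by rewrite mul0mx mulmxA -vw -mulmxA HK mulmx0.
Qed.

End SkewLinearAlgebra.

(** * The inner product on matrices *)

Section SkewDot.
Context {R : realType} {n : nat}.
Implicit Types X Y Z : 'M[R]_n.

Lemma skew_dotC X Y : skew_dot X Y = skew_dot Y X.
Proof. by rewrite /skew_dot -mxtrace_tr trmx_mul trmxK. Qed.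

Lemma skew_dotDl X X' Y : skew_dot (X + X') Y = skew_dot X Y + skew_dot X' Y.
Proof. by rewrite /skew_dot mulmxDl mxtraceD mulrDr. Qed.

Lemma skew_dotZl a X Y : skew_dot (a *: X) Y = a * skew_dot X Y.
Proof. by rewrite /skew_dot -scalemxAl mxtraceZ mulrCA. Qed.

Lemma skew_dotNl X Y : skew_dot (- X) Y = - skew_dot X Y.
Proof. by rewrite -scaleN1r skew_dotZl mulN1r. Qed.

Lemma skew_dot_suml I (r : seq I) (P : pred I) (F : I -> 'M[R]_n) Y :
  skew_dot (\sum_(i <- r | P i) F i) Y = \sum_(i <- r | P i) skew_dot (F i) Y.
Proof. by rewrite /skew_dot mulmx_suml raddf_sum /= mulr_sumr. Qed.

Lemma skew_dot_eq0 X : skew_dot X X = 0 -> X = 0.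
Proof.
move=> /eqP; rewrite mulf_eq0 invr_eq0 pnatr_eq0 /= => /eqP.
have ge0 i : 0 <= (X *m X^T) i i.
  by rewrite mxE sumr_ge0 // => j _; rewrite mxE -expr2 sqr_ge0.
move=> /psumr_eq0P h; apply/matrixP => i j; rewrite mxE.
have := h (fun i _ => ge0 i) i isT; rewrite mxE.
under eq_bigr do rewrite mxE -expr2.
move=> /psumr_eq0P h'; apply/eqP; rewrite -sqrf_eq0; apply/eqP/h' => //.
by move=> *; exact: sqr_ge0.
Qed.

(** Matrix units are orthogonal of squared norm 1/2; this is the source of the factor 2 when a
    metric contraction is expanded in them. *)
Lemma skew_dot_delta t s X : skew_dot (delta_mx t s) X = 2^-1 * X t s.
Proof.
rewrite /skew_dot -(mul_delta_mx (0 : 'I_1)) -mulmxA mxtrace_mulC -rowE -colE.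
by rewrite /mxtrace big_ord1 !mxE.
Qed.

Lemma skew_dot_tr X Y : skew_dot X^T Y = skew_dot X Y^T.
Proof. by rewrite /skew_dot trmxK -trmx_mul mxtrace_tr mxtrace_mulC. Qed.

Lemma skew_dot_mul A X Y :
  skew_dot (A *m X *m A) Y = skew_dot X (A^T *m Y *m A^T).
Proof.
rewrite /skew_dot !trmx_mul !trmxK; congr (_ * _).
by rewrite -!mulmxA mxtrace_mulC !mulmxA.
Qed.

End SkewDot.

(** * Orthogonal projection onto the span of the partial derivatives *)

Section TangentComponent.
Context {R : realType} {k n : nat}.
Variables (phi : 'rV[R]_k -> 'M[R]_n) (u : 'rV[R]_k).
Local Notation Z i := (pderiv i phi u).
Hypothesis Zfree : forall c : 'I_k -> R, \sum_i c i *: Z i = 0 ->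
  forall i, c i = 0.
Local Notation g := (first_fundamental_form (@skew_dot R n) phi u).

(** A vector in the kernel of the Gram matrix gives a combination of the [Z i] orthogonal to every
    [Z j], hence to itself, hence zero; independence then kills its coefficients. *)
Lemma first_fundamental_form_unitmx : g \in unitmx.
Proof.
apply: unitmx_inj => v vg; apply/rowP => i; rewrite mxE.
apply: (Zfree (c := v 0)); apply: skew_dot_eq0.
rewrite skew_dot_suml big1 // => j _; rewrite skew_dotZl skew_dotC.
rewrite skew_dot_suml; move/rowP/(_ j): vg; rewrite !mxE.
under eq_bigr do rewrite mxE -skew_dotZl.
by move->; rewrite mulr0.
Qed.

Lemma first_fundamental_form_sym : g^T = g.
Proof. by apply/matrixP => i j; rewrite !mxE skew_dotC. Qed.

(** An orthogonal projection is characterized by lying in the span and leaving an orthogonal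
    remainder, so it can be identified without computing the inverse metric. *)
Lemma tangent_componentE (w t : 'M[R]_n) (c : 'I_k -> R) :
  t = \sum_i c i *: Z i -> (forall j, skew_dot (w - t) (Z j) = 0) ->
  tangent_component (@skew_dot R n) phi u w = t.
Proof.
move=> tE wt; rewrite tE; apply: eq_bigr => i _; rewrite -scaler_suml.
congr (_ *: _).
have -> : c i = ((\row_l c l) *m g *m invmx g) 0 i.
  by rewrite mulmxK ?mxE ?first_fundamental_form_unitmx.
rewrite mxE; apply: eq_bigr => j _; rewrite mulrC; congr (_ * _); last first.
  by rewrite -[in LHS]first_fundamental_form_sym -trmx_inv mxE.
have /eqP := wt j; rewrite skew_dotDl skew_dotNl subr_eq0 => /eqP ->.
rewrite tE skew_dot_suml mxE; apply: eq_bigr => l _.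
by rewrite skew_dotZl !mxE.
Qed.

(* Expand Z j in the matrix units, whose products with Z j are half its
   entries. *)
Lemma inverse_metric_contraction (G : 'M[R]_n) :
  \sum_i \sum_j invmx g i j *: (Z i *m G *m Z j) =
  \sum_t \sum_s (2 *: tangent_component (@skew_dot R n) phi u (delta_mx t s))
                *m G *m delta_mx t s.
Proof.
rewrite pair_big /= [RHS]pair_big /=.
under [RHS]eq_bigr do
  rewrite /tangent_component pair_big /= scaler_sumr !mulmx_suml.
rewrite exchange_big /=; apply: eq_bigr => -[i j] _ /=.
rewrite [X in _ *m X]matrix_sum_delta pair_big /= mulmx_sumr scaler_sumr.
apply: eq_bigr => -[t s] _ /=.
rewrite skew_dot_delta scalerA mulrCA mulVKf ?pnatr_eq0 //.
by rewrite -!scalemxAl -scalemxAr scalerA.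
Qed.

End TangentComponent.

(** * Skew frames and the tangent space of the regular points *)

Section SkewFrames.
Context {R : fieldType}.

(** A linear map whose kernel expresses skewness of the top block, so that the frames form a
    [vspace] with a dimension. *)
Definition upper_symmetrization m q (Z : 'M[R]_(m + q, m)) : 'M[R]_m :=
  usubmx Z + (usubmx Z)^T.

Fact upper_symmetrization_linear m q : linear (@upper_symmetrization m q).
Proof.
move=> a Z Z'; rewrite /upper_symmetrization linearP linearP /= scalerDr.
by rewrite addrACA.
Qed.

HB.instance Definition _ m q := GRing.isLinear.Build _ _ _ _
  (@upper_symmetrization m q) (@upper_symmetrization_linear m q).

(* Its elements [A; C], with A skew of size m, are the coordinates of a
   skew matrix of rank m near a given one; they also encode its tangent
   vectors. *)
Definition skew_frames m q : {vspace 'M[R]_(m + q, m)} :=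
  lker (linfun (@upper_symmetrization m q)).

Lemma mem_skew_frames m q (Z : 'M[R]_(m + q, m)) :
  (Z \in skew_frames m q) = ((usubmx Z)^T == - usubmx Z).
Proof. by rewrite memv_ker lfunE /= /upper_symmetrization addrC addr_eq0. Qed.

End SkewFrames.

Lemma conj_unit_inj (R : fieldType) n (P X Y : 'M[R]_n) : P \in unitmx ->
  P *m X *m P^T = P *m Y *m P^T -> X = Y.
Proof.
move=> Pu /(can_inj (mulmxK _)); rewrite unitmx_tr => /(_ Pu).
exact: (can_inj (mulKmx Pu)).
Qed.

Section TangentSpace.
Context {R : fieldType} {m q : nat}.
Local Notation S := (skew_frames m q : {vspace 'M[R]_(m + q, m)}).
Variables (H : 'M[R]_(m, m + q)) (K : 'M[R]_(q, m + q)).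
Hypothesis Pu : col_mx H K \in unitmx.

(** Skewness and vanishing on the kernel, packed into one linear map so that the tangent space is a
    kernel. *)
Definition tangent_conditions (W : 'M[R]_(m + q)) :
    ('M[R]_(m + q) * 'M[R]_q)%type := (W + W^T, K *m W *m K^T).

Fact tangent_conditions_linear : linear tangent_conditions.
Proof.
move=> a W W'; congr (_, _) => /=.
  by rewrite linearP scalerDr addrACA.
by rewrite mulmxDr mulmxDl -scalemxAr -scalemxAl.
Qed.

HB.instance Definition _ := GRing.isLinear.Build _ _ _ _
  tangent_conditions tangent_conditions_linear.

Definition tangent_space : {vspace 'M[R]_(m + q)} :=
  lker (linfun tangent_conditions).

Lemma mem_tangent_space W :
  (W \in tangent_space) = (W^T == - W) && (K *m W *m K^T == 0).
Proof.
by rewrite memv_ker lfunE /= /tangent_conditions -pair_eqE /= addrC addr_eq0.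
Qed.

(** A tangent [W] is determined by [H W H^T] and [K W H^T]: the block [K W K^T] vanishes and
    [H W K^T] follows by skewness. Stacked, these two blocks form a skew frame, which gives an
    injection into [S]. *)
Lemma dim_tangent_space_leq : (\dim tangent_space <= \dim S)%N.
Proof.
pose f : 'Hom('M[R]_(m + q), 'M[R]_(m + q, m)) :=
  linfun (mulmxr H^T \o mulmx (col_mx H K)).
have fE W : f W = col_mx (H *m W *m H^T) (K *m W *m H^T).
  by rewrite lfunE /= !mul_col_mx.
rewrite -(@limg_dim_eq _ _ _ f).
  apply: dimvS; apply/subvP => _ /memv_imgP[W + ->].
  rewrite mem_tangent_space mem_skew_frames fE col_mxKu => /andP[/eqP WT _].
  by rewrite !trmx_mul WT trmxK mulNmx mulmxN mulmxA.
apply/eqP; rewrite -subv0; apply/subvP => W; rewrite memv_cap memv_ker memv0.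
rewrite mem_tangent_space fE => /andP[/andP[/eqP WT /eqP KK]].
rewrite col_mx_eq0 => /andP[/eqP HH /eqP KH].
apply/eqP; apply: (conj_unit_inj Pu).
rewrite conj_col_mx mulmx0 mul0mx HH KK KH.
suff -> : H *m W *m K^T = 0 by rewrite /block_mx !row_mx0 col_mx0.
apply: trmx_inj; rewrite !trmx_mul trmxK WT mulNmx mulmxN mulmxA KH.
by rewrite oppr0 trmx0.
Qed.

(** Here [\dim S] independent vectors lie in a space of dimension at most [\dim S], so they form a
    basis of it. *)
Lemma tangent_space_span (Z : 'I_(\dim S) -> 'M[R]_(m + q)) W :
  (forall c, \sum_i c i *: Z i = 0 -> forall i, c i = 0) ->
  (forall i, Z i \in tangent_space) -> W \in tangent_space ->
  exists c, W = \sum_i c i *: Z i.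
Proof.
move=> Zfree ZT WT; pose X := [tuple Z i | i < \dim S].
have Xi (i : 'I__) : X`_i = Z i by rewrite -tnth_nth tnth_mktuple.
have Xf : free X.
  apply/freeP => c cX; apply: Zfree; rewrite -[RHS]cX.
  by apply: eq_bigr => i _; rewrite Xi.
have Xs : (<<X>> <= tangent_space)%VS.
  by apply/span_subvP => _ /mapP[i _ ->].
have XT : <<X>>%VS = tangent_space.
  apply/eqP; rewrite eqEdim Xs /=.
  move: Xf; rewrite /free => /eqP ->.
  by rewrite size_tuple dim_tangent_space_leq.
exists (fun i => coord X i W); rewrite [LHS](coord_span (X := X)) ?XT //.
by apply: eq_bigr => i _; rewrite Xi.
Qed.

End TangentSpace.

(** * Vanishing of the mean curvature from first and second order identities *)

Lemma sum_symmetrized (R : comNzRingType) (W : lmodType R) k (g : 'M[R]_k)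
    (F : 'I_k -> 'I_k -> W) : g^T = g ->
  \sum_i \sum_j g i j *: (F i j + F j i) = 2 *: \sum_i \sum_j g i j *: F i j.
Proof.
move=> gT; rewrite scaler_nat mulr2n.
under eq_bigr do under eq_bigr do rewrite scalerDr.
under eq_bigr do rewrite big_split /=.
rewrite big_split /=; congr (_ + _).
rewrite exchange_big /=; apply: eq_bigr => i _; apply: eq_bigr => j _.
by rewrite -[in LHS]gT mxE.
Qed.

Section MeanCurvature.
Context {R : realType} {m q : nat}.
Local Notation n := (m + q)%N.
Local Notation k := (\dim (skew_frames m q : {vspace 'M[R]_(m + q, m)})).
Variables (H : 'M[R]_(m, n)) (K : 'M[R]_(q, n)) (B : 'M[R]_m).
Variables (phi : 'rV[R]_k -> 'M[R]_n) (u : 'rV[R]_k).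
Local Notation Z i := (pderiv i phi u).
Local Notation D i j := (pderiv i (pderiv j phi) u).
Local Notation g := (first_fundamental_form (@skew_dot R n) phi u).
Local Notation G := (H^T *m B *m H).

Hypothesis Pu : col_mx H K \in unitmx.
Hypothesis HK : H *m K^T = 0.
Hypothesis BT : B^T = - B.
Hypothesis Zfree : forall c : 'I_k -> R, \sum_i c i *: Z i = 0 ->
  forall i, c i = 0.
Hypothesis ZT : forall i, (Z i)^T = - Z i.
Hypothesis KZK : forall i, K *m Z i *m K^T = 0.
Hypothesis DT : forall i j, (D i j)^T = - D i j.
Hypothesis KDK : forall i j, K *m D i j *m K^T =
  K *m (Z i *m G *m Z j + Z j *m G *m Z i) *m K^T.

Variables (N : 'M[R]_q) (Pi : 'M[R]_n).
Hypothesis PiE : Pi = K^T *m N *m K.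
Hypothesis KPi : K *m Pi = K.
Hypothesis PiT : Pi^T = Pi.

Let PiK : Pi *m K^T = K^T.
Proof. by rewrite -[in LHS]PiT -trmx_mul KPi. Qed.

(** [Pi] is the orthogonal projection onto the row space of [K]. The skew part of [W] minus its
    compression by [Pi] satisfies the tangent conditions, and the remainder is orthogonal to every
    [Z j] because [Z j] is skew and [Pi Z j Pi = 0]. *)
Lemma tangent_component_skew (W : 'M[R]_n) :
  tangent_component (@skew_dot R n) phi u W =
  2^-1 *: ((W - W^T) - Pi *m (W - W^T) *m Pi).
Proof.
set A := W - W^T; set t := _ *: _.
have AT : A^T = - A by rewrite /A linearB /= trmxK opprB.
have tT : t^T = - t.
  rewrite /t linearZ /= linearB /= trmx_mul PiT trmx_mul PiT AT.
  rewrite mulNmx mulmxN mulmxA.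
  by rewrite -opprD scalerN.
have KtK : K *m t *m K^T = 0.
  rewrite /t -scalemxAr -scalemxAl mulmxBr mulmxBl !mulmxA KPi.
  by rewrite -[_ *m Pi *m _]mulmxA PiK subrr scaler0.
have ZK i : Z i \in tangent_space K by rewrite mem_tangent_space ZT KZK !eqxx.
have [|c tE] := tangent_space_span Pu Zfree ZK (W := t).
  by rewrite mem_tangent_space tT KtK !eqxx.
apply: (tangent_componentE Zfree tE) => j.
have PZP : Pi *m Z j *m Pi = 0.
  have -> : Pi *m Z j *m Pi = K^T *m N *m (K *m Z j *m K^T) *m N *m K.
    by rewrite PiE !mulmxA.
  by rewrite KZK mulmx0 !mul0mx.
rewrite skew_dotDl skew_dotNl skew_dotZl skew_dotDl skew_dotNl skew_dot_mul.
rewrite PiT PZP.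
have -> : skew_dot A 0 = 0 by rewrite /skew_dot trmx0 mulmx0 mxtrace0 mulr0.
rewrite subr0.
rewrite /A skew_dotDl skew_dotNl skew_dot_tr ZT.
have -> : skew_dot W (- Z j) = - skew_dot W (Z j).
  by rewrite skew_dotC skew_dotNl skew_dotC.
rewrite opprK -mulr2n -[X in _ * X]mulr_natl mulrA mulVf ?pnatr_eq0 //.
by rewrite mul1r subrr.
Qed.

Let GT : G^T = - G.
Proof. by rewrite !trmx_mul trmxK BT mulNmx mulmxN mulmxA. Qed.

(* Summed over the matrix units E, the terms E G E give G^T, which K kills, and
   the terms E^T G E carry the diagonal entries of the skew matrix G. *)
Lemma inverse_metric_skew_contraction :
  K *m (\sum_i \sum_j invmx g i j *: (Z i *m G *m Z j)) *m K^T = 0.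
Proof.
have KH : K *m H^T = 0 by apply: trmx_inj; rewrite trmx_mul trmxK HK trmx0.
rewrite inverse_metric_contraction.
transitivity (K *m G^T *m K^T); last first.
  by rewrite GT mulmxN mulNmx !mulmxA KH !mul0mx oppr0.
congr (_ *m _); rewrite [G^T]matrix_sum_delta !mulmx_sumr.
apply: eq_bigr => t _; rewrite !mulmx_sumr; apply: eq_bigr => s _.
rewrite tangent_component_skew scalerA divff ?pnatr_eq0 // scale1r.
rewrite !mulmxA; set E := delta_mx t s.
(* The compressed part of the tangent component ends in [Pi], which meets the [H^T] of [G] and
   disappears. *)
have PG A : A *m Pi *m H^T = 0.
  by rewrite PiE -!mulmxA KH !mulmx0.
rewrite mulmxBr [_ *m H^T]mulmxBl !mulmxA PG subr0.
have -> : E^T = delta_mx s t by apply/matrixP => i j; rewrite !mxE andbC.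
rewrite mulmxBr !mulmxBl.
have -> : K *m E *m H^T *m B *m H *m E = K *m (E *m G *m E) by rewrite !mulmxA.
have -> : K *m delta_mx s t *m H^T *m B *m H *m E =
  K *m (delta_mx s t *m G *m E) by rewrite !mulmxA.
rewrite !mulmx_delta.
have -> : G t t = 0.
  have /matrixP/(_ t t) := GT; rewrite mxE [RHS]mxE => /eqP.
  by rewrite -addr_eq0 -mulr2n mulrn_eq0 /= => /eqP.
by rewrite scale0r mulmx0 subr0 [G^T _ _]mxE.
Qed.

(** On skew matrices the normal component is [W |-> Pi W Pi], so [KDK] turns the second fundamental
    form into [Pi (Z_i G Z_j + Z_j G Z_i) Pi]. By symmetry of the inverse metric its trace is twice
    a contraction that vanishes between [K] and [K^T]. *)
Lemma mean_curvature_skew_eq0 : mean_curvature (@skew_dot R n) phi u = 0.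
Proof.
rewrite /mean_curvature.
have PAP A : Pi *m A *m Pi = K^T *m N *m (K *m A *m K^T) *m N *m K.
  by rewrite PiE !mulmxA.
have IIE i j : second_fundamental_form (@skew_dot R n) phi u i j =
    Pi *m (Z i *m G *m Z j + Z j *m G *m Z i) *m Pi.
  rewrite PAP -KDK -PAP /second_fundamental_form /normal_component.
  rewrite tangent_component_skew DT opprK -mulr2n -[D i j *+ 2]scaler_nat.
  rewrite -scalemxAr -scalemxAl -scalerBr scalerA mulVf ?pnatr_eq0 // scale1r.
  by rewrite opprB addrC subrK.
under eq_bigr do under eq_bigr do rewrite IIE scalemxAl scalemxAr.
under eq_bigr do rewrite -mulmx_suml -mulmx_sumr.
rewrite -mulmx_suml -mulmx_sumr.
suff -> : \sum_i \sum_j invmx g i j *: (Z i *m G *m Z j + Z j *m G *m Z i) =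
    2 *: \sum_i \sum_j invmx g i j *: (Z i *m G *m Z j).
  rewrite PAP -scalemxAr -scalemxAl inverse_metric_skew_contraction.
  by rewrite scaler0 mulmx0 !mul0mx.
apply: (sum_symmetrized (fun i j => Z i *m G *m Z j)).
by rewrite trmx_inv first_fundamental_form_sym.
Qed.

End MeanCurvature.

(** * Differentiating skewness and constant rank *)

Lemma skew_invmx (R : fieldType) a (A : 'M[R]_a) :
  A \in unitmx -> A^T = - A -> (invmx A)^T = - invmx A.
Proof.
move=> Au AT; rewrite trmx_inv AT -[in LHS]scaleN1r invmxZ ?invrN1 ?scaleN1r //.
by rewrite -AT unitmx_tr.
Qed.

Lemma trmx_mul_skew (R : comNzRingType) a b c n (C : 'M[R]_(a, b))
    (H : 'M[R]_(b, n)) (X : 'M[R]_n) (N : 'M[R]_(c, n)) : X^T = - X ->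
  (C *m (H *m X *m N^T))^T = - (N *m X *m (C *m H)^T).
Proof.
by move=> XT; rewrite !trmx_mul trmxK XT mulNmx mulmxN mulNmx !mulmxA.
Qed.

(** Write [N = S H + T K]. Multiplying by [p] and then [H^T] leaves [S (H p H^T) = 0], so [S]
    vanishes. *)
Lemma kernel_factor (R : fieldType) m q a (p : 'M[R]_(m + q))
    (H : 'M[R]_(m, m + q)) (K : 'M[R]_(q, m + q))
    (N : 'M[R]_(a, m + q)) :
  col_mx H K \in unitmx -> K *m p = 0 -> H *m p *m H^T \in unitmx ->
  N *m p = 0 -> exists T, N = T *m K.
Proof.
move=> Pu Kp Au Np; set T := N *m invmx (col_mx H K).
have NE : N = lsubmx T *m H + rsubmx T *m K.
  by rewrite -mul_row_col hsubmxK mulmxKV.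
exists (rsubmx T).
suff T0 : lsubmx T = 0 by rewrite [LHS]NE T0 mul0mx add0r.
apply: (can_inj (mulmxK Au)); rewrite mul0mx !mulmxA.
move: Np; rewrite NE mulmxDl -[rsubmx T *m K *m p]mulmxA Kp mulmx0 addr0.
by move=> ->; rewrite mul0mx.
Qed.

Section ConstantRank.
Context {R : realType} {V : normedModType R} {m q : nat}.
Local Notation n := (m + q)%N.

Variables (phi : V -> 'M[R]_n) (x : V).
Hypothesis phi_cvg : phi y @[y --> x] --> phi x.
Hypothesis phi_skew : \forall y \near x, (phi y)^T = - phi y.
Hypothesis phi_rank : \forall y \near x, \rank (phi y) = m.
Implicit Types (H : 'M[R]_(m, n)) (K : 'M[R]_(q, n)).

(** Invertibility of the compression persists by continuity, and as the rank stays [m] the Schur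
    complement must vanish. *)
Lemma near_schur H K : H *m phi x *m H^T \in unitmx -> col_mx H K \in unitmx ->
  \forall y \near x, H *m phi y *m H^T \in unitmx /\
    K *m phi y *m K^T = K *m phi y *m H^T *m invmx (H *m phi y *m H^T)
                        *m (H *m phi y *m K^T).
Proof.
move=> Au Pu.
have AU : \forall y \near x, H *m phi y *m H^T \in unitmx.
  apply: (near_unitmx Au); apply: cvg_mulmx (cvg_cst _).
  by apply: cvg_mulmx phi_cvg; exact: cvg_cst.
near=> y; have yu : H *m phi y *m H^T \in unitmx by near: y.
split=> //; apply: (schur_complement_eq0 yu); rewrite -conj_col_mx.
by rewrite mxrank_conj_unit //; near: y.
Unshelve. all: by end_near. Qed.

(** It suffices to take [N = K]. Near [x], [K phi K^T] is [K phi H^T], which vanishes at [x], times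
    [g]. Its derivative is therefore [K dphi H^T g x], and [g x] contains the factor
    [H phi x K^T = 0]. *)
Lemma kernel_derive a (N : 'M[R]_(a, n)) v dphi :
  is_derive x v phi dphi -> N *m phi x = 0 -> N *m dphi *m N^T = 0.
Proof.
move=> phid Np; have pT := nbhs_singleton phi_skew.
have [H [K [Kp _ Au _ Pu]]] := skew_rank_splitting pT (nbhs_singleton phi_rank).
have pK : phi x *m K^T = 0.
  by apply: trmx_inj; rewrite trmx_mul trmxK pT mulmxN Kp oppr0 trmx0.
have [T ->] := kernel_factor Pu Kp Au Np.
suff KdK : K *m dphi *m K^T = 0.
  have -> : T *m K *m dphi *m (T *m K)^T = T *m (K *m dphi *m K^T) *m T^T.
    by rewrite trmx_mul !mulmxA.
  by rewrite KdK mulmx0 mul0mx.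
have d1 : is_derive x v (fun y => K *m phi y *m K^T) (K *m dphi *m K^T).
  exact: (is_derive_linear_mx (mulmxr K^T \o mulmx K) phid).
have lineA := cvg_comp _ _ (@cvg_line _ _ x v) phi_cvg.
pose g y := invmx (H *m phi y *m H^T) *m (H *m phi y *m K^T).
have gl : g (h *: v + x) @[h --> 0^'] --> g x.
  apply: cvg_mulmx; [apply: (cvg_invmx Au)|]; apply: cvg_mulmx (cvg_cst _);
    exact: cvg_mulmx (cvg_cst _) lineA.
have d2 : is_derive x v (fun y => K *m phi y *m H^T *m g y)
    (K *m dphi *m H^T *m g x).
  apply: is_derive_mulmx0l gl; first by rewrite Kp mul0mx.
  exact: (is_derive_linear_mx (mulmxr H^T \o mulmx K) phid).
rewrite (is_derive_near_unique _ d1 d2).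
  by rewrite /g -[H *m phi x *m K^T]mulmxA pK !mulmx0.
by apply: filterS (near_schur Au Pu) => y [_ ->]; rewrite /g !mulmxA.
Qed.

Variables (psi : V -> 'M[R]_n) (v : V) (dphi dpsi : 'M[R]_n).
Hypothesis psi_skew : \forall y \near x, (psi y)^T = - psi y.
Hypothesis psi_kernel : \forall y \near x, forall N : 'M[R]_(q, n),
  N *m phi y = 0 -> N *m psi y *m N^T = 0.
Hypothesis dphiE : is_derive x v phi dphi.
Hypothesis dpsiE : is_derive x v psi dpsi.

(* The rows of K - C y H span the kernel of phi y, where C y vanishes at x;
   differentiating (K - C H) psi (K - C H)^T = 0 leaves only terms with a
   derivative of C. *)
Lemma kernel_second_derive H K :
  let G := H^T *m invmx (H *m phi x *m H^T) *m H in
  col_mx H K \in unitmx -> K *m phi x = 0 -> H *m phi x *m H^T \in unitmx ->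
  K *m dpsi *m K^T = K *m (dphi *m G *m psi x + psi x *m G *m dphi) *m K^T.
Proof.
move=> G Pu Kp Au; have pT := nbhs_singleton phi_skew.
pose B y := invmx (H *m phi y *m H^T).
pose C y := K *m phi y *m H^T *m B y.
pose N y := K - C y *m H.
have C0 : C x = 0 by rewrite /C Kp !mul0mx.
(* This is [N psi N^T = 0] expanded so that every term carries the factor [C y] or its transpose.
   Since [C] vanishes at [x], the other factors need only limits. *)
have KH : \forall y \near x, K *m psi y *m K^T =
    C y *m (H *m psi y *m K^T) - (C y *m (H *m psi y *m (N y)^T))^T.
  apply: (filterS3 _ _ (near_schur Au Pu) psi_skew psi_kernel) => y [yu yS] ysk.
  have PTu : (col_mx H K)^T \in unitmx by rewrite unitmx_tr.
  (* Tested against [H^T] this is the definition of [C y]; against [K^T] it is the vanishing Schur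
     complement. *)
  have /[swap] /[apply] : N y *m phi y = 0.
    apply: (can_inj (mulmxK PTu)); rewrite mul0mx tr_col_mx mul_mx_row.
    rewrite !mulmxBl yS /C -!mulmxA (mulmxA H) (mulmxA H (phi y)) mulVmx //.
    by rewrite mulmx1 !subrr row_mx0.
  rewrite trmx_mul_skew // opprK.
  rewrite {2}/N linearB /= mulmxBr {1}/N !mulmxBl => /eqP.
  by rewrite subr_eq0 subr_eq addrC => /eqP ->; rewrite !mulmxA.
have dphiT : dphi^T = - dphi.
  exact: (is_derive_near_unique phi_skew (is_derive_linear_mx trmx dphiE)
            (is_deriveN dphiE)).
have psiT := nbhs_singleton psi_skew.
have lphi := is_derive_cvg dphiE; have lpsi := is_derive_cvg dpsiE.
have dC : is_derive x v C (K *m dphi *m H^T *m B x).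
  apply: is_derive_mulmx0l; first by rewrite Kp mul0mx.
    exact: (is_derive_linear_mx (mulmxr H^T \o mulmx K) dphiE).
  apply: (cvg_invmx Au); apply: cvg_mulmx (cvg_cst _).
  exact: cvg_mulmx (cvg_cst _) lphi.
have lN : N (h *: v + x) @[h --> 0^'] --> K.
  rewrite -[X in _ --> X]subr0 -(mul0mx _ H) -C0.
  apply: cvgB; first exact: cvg_cst.
  exact: cvg_mulmx (is_derive_cvg dC) (cvg_cst _).
have d1 : is_derive x v (fun y => C y *m (H *m psi y *m K^T))
    (K *m dphi *m H^T *m B x *m (H *m psi x *m K^T)).
  apply: is_derive_mulmx0l C0 dC _; apply: cvg_mulmx (cvg_cst _).
  exact: cvg_mulmx (cvg_cst _) lpsi.
have d2 : is_derive x v (fun y => (C y *m (H *m psi y *m (N y)^T))^T)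
    (K *m dphi *m H^T *m B x *m (H *m psi x *m K^T))^T.
  apply: (is_derive_linear_mx trmx); apply: is_derive_mulmx0l C0 dC _.
  apply: cvg_mulmx; first exact: cvg_mulmx (cvg_cst _) lpsi.
  exact: (cvg_linear_mx (L := trmx) lN).
have d3 : is_derive x v (fun y => K *m psi y *m K^T) (K *m dpsi *m K^T).
  exact: (is_derive_linear_mx (mulmxr K^T \o mulmx K) dpsiE).
rewrite (is_derive_near_unique KH d3 (is_deriveB d1 d2)).
have BT : (B x)^T = - B x.
  by apply: skew_invmx => //; rewrite !trmx_mul trmxK pT mulNmx mulmxN mulmxA.
rewrite trmx_mul_skew // opprK mulmxDr mulmxDl /G -/(B x).
rewrite trmx_mul (trmx_mul _ (B x)) BT !trmx_mul trmxK dphiT.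
by rewrite !(mulmxN, mulNmx) opprK !mulmxA.
Qed.

End ConstantRank.

(** The values of an arbitrary parametrization are skew of constant rank on an open set;
    differentiating these facts once and twice supplies every hypothesis of the pointwise
    computation. *)
Lemma pfaffian_mean_curvature_eq0 (R : realType) (r q : nat)
    (k := \dim (skew_frames (2 * r) q : {vspace 'M[R]_(2 * r + q, 2 * r)}))
    (U : set 'rV[R]_k) (phi : 'rV[R]_k -> 'M[R]_(2 * r + q)) u :
  local_parametrization (pfaffian_regular R (2 * r + q) r) U phi -> U u ->
  mean_curvature (@skew_dot R (2 * r + q)) phi u = 0.
Proof.
move=> [oU smU immU [W [psi [_ imU _ _]]]] Uu.
have nearU x : U x -> \forall y \near x, U y.
  by move=> Ux; exact: open_nbhs_nbhs.
have phiM x : U x -> (phi x)^T = - phi x /\ \rank (phi x) = (2 * r)%N.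
  move=> Ux; have [[[]]] : (pfaffian_regular R (2 * r + q) r `&` W) (phi x).
    by rewrite -imU; exists x.
  by rewrite /Skew /= skewmxE => /eqP.
have [_ dphi Cphi] := smU 2%N.
have cphi x : U x -> phi y @[y --> x] --> phi x.
  by move=> Ux; have [+ _ _] := smU 1%N; apply; rewrite inE.
have phiT x : U x -> \forall y \near x, (phi y)^T = - phi y.
  by move=> /nearU; apply: filterS => y /phiM[].
have phir x : U x -> \forall y \near x, \rank (phi y) = (2 * r)%N.
  by move=> /nearU; apply: filterS => y /phiM[].
have d1 i x : U x -> is_derive x (delta_mx 0 i) phi (pderiv i phi x).
  by move=> Ux; split => //; exact: dphi.
have d2 i j x : U x ->
    is_derive x (delta_mx 0 i) (pderiv j phi) (pderiv i (pderiv j phi) x).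
  by move=> Ux; split => //; have [_ + _] := Cphi j; exact.
have ZT i x : U x -> (pderiv i phi x)^T = - pderiv i phi x.
  move=> Ux; apply: (is_derive_near_unique (phiT x Ux)).
    exact: (is_derive_linear_mx trmx (d1 i x Ux)).
  exact: (is_deriveN (d1 i x Ux)).
have nearZT i x : U x ->
    \forall y \near x, (pderiv i phi y)^T = - pderiv i phi y.
  by move=> /nearU; apply: filterS => y; exact: ZT.
have DT i j x : U x ->
    (pderiv i (pderiv j phi) x)^T = - pderiv i (pderiv j phi) x.
  move=> Ux; apply: (is_derive_near_unique (nearZT j x Ux)).
    exact: (is_derive_linear_mx trmx (d2 i j x Ux)).
  exact: (is_deriveN (d2 i j x Ux)).
have kerZ i x : U x -> forall a (N : 'M[R]_(a, _)), N *m phi x = 0 ->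
    N *m pderiv i phi x *m N^T = 0.
  move=> Ux a N; apply: (kernel_derive (cphi x Ux) (phiT x Ux) (phir x Ux)).
  exact: d1.
have [pT pr] := phiM u Uu.
have [H [K [Kp HK Au KKu Pu]]] := skew_rank_splitting pT pr.
(* With this choice [K^T N K] is the orthogonal projection onto the kernel of [phi u]. *)
pose N := invmx (K *m K^T).
have NT : N^T = N by rewrite /N trmx_inv trmx_mul trmxK.
apply: (@mean_curvature_skew_eq0 _ _ _ H K (invmx (H *m phi u *m H^T)) phi u
  Pu HK _ (immU u Uu) _ _ _ _ N (K^T *m N *m K)) => //.
- by apply: skew_invmx => //; rewrite !trmx_mul trmxK pT mulNmx mulmxN mulmxA.
- by move=> i; exact: ZT.
- by move=> i; exact: kerZ.
- by move=> i j; exact: DT.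
- move=> i j.
  (* The first-order identity holds at all points near [u], so [pderiv j phi] can serve as [psi] and
     be differentiated in direction [i]. *)
  have kerU : \forall y \near u, forall M : 'M[R]_(q, _), M *m phi y = 0 ->
      M *m pderiv j phi y *m M^T = 0.
    by apply: filterS (nearU u Uu) => y Uy M; exact: kerZ.
  exact: (kernel_second_derive (cphi u Uu) (phiT u Uu) (phir u Uu)
    (nearZT j u Uu) kerU (d1 i u Uu) (d2 i j u Uu) Pu Kp Au).
- by rewrite !mulmxA mulmxV // mul1mx.
- by rewrite !trmx_mul trmxK NT mulmxA.
Qed.

(** * Polynomial charts of the regular points *)

Lemma vspace_coordinates (R : fieldType) a b (S : {vspace 'M[R]_(a, b)}) :
  exists (l : {linear 'rV[R]_(\dim S) -> 'M[R]_(a, b)})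
         (c : {linear 'M[R]_(a, b) -> 'rV[R]_(\dim S)}),
    [/\ forall u, l u \in S, cancel l c & {in S, cancel c l}].
Proof.
pose B : 'M[R]_(\dim S, a * b) := \matrix_i mxvec (vbasis S)`_i.
pose l := vec_mx \o mulmxr B : {linear 'rV[R]_(\dim S) -> 'M[R]_(a, b)}.
(* The pseudo-inverse makes [c] linear on all matrices; it inverts [l] because the rows of [B] are
   independent. *)
pose c := mulmxr (pinvmx B) \o mxvec : {linear 'M[R]_(a, b) -> 'rV[R]_(\dim S)}.
have lE u : l u = \sum_i u 0 i *: (vbasis S)`_i.
  rewrite /l /= mulmx_sum_row linear_sum; apply: eq_bigr => i _.
  by rewrite linearZ /= rowK mxvecK.
have Bf : row_free B.
  rewrite -kermx_eq0; apply/eqP/row_matrixP => j; rewrite row0.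
  apply/rowP => i; rewrite [RHS]mxE.
  have /freeP/(_ (row j (kermx B) 0)) := basis_free (vbasisP S); apply.
  by rewrite -lE /l /= -row_mul mulmx_ker row0 linear0.
have lK : cancel l c by move=> u; rewrite /c /l /= vec_mxK mulmxKp.
exists l, c; split=> // [u|Z ZS].
  rewrite lE; apply: memv_suml => i _; apply: memvZ.
  by apply: vbasis_mem; rewrite mem_nth ?size_tuple.
have -> : Z = l (\row_i coord (vbasis S) i Z).
  by rewrite lE [LHS](coord_vbasis ZS); apply: eq_bigr => i _; rewrite mxE.
by rewrite lK.
Qed.

Section Parametrization.
Context {R : realType} {r q : nat}.
Local Notation m := (2 * r)%N.
Local Notation n := (m + q)%N.
Local Notation S := (skew_frames m q : {vspace 'M[R]_(n, m)}).
Local Notation k := (\dim S).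
Variables (l : {linear 'rV[R]_k -> 'M[R]_(n, m)})
  (c : {linear 'M[R]_(n, m) -> 'rV[R]_k}).
Hypothesis lS : forall u, l u \in S.
Hypothesis lK : cancel l c.
Hypothesis cK : {in S, cancel c l}.
Variables (H : 'M[R]_(m, n)) (K : 'M[R]_(q, n)).
Hypothesis Pu : col_mx H K \in unitmx.

Local Notation P := (col_mx H K).
Local Notation A u := (usubmx (l u)).
Local Notation C u := (dsubmx (l u)).

(** A constant plus a linear map, the form that [mxpoly_map] accepts, for the column with blocks [1]
    and [C u]. *)
Definition frame_column (u : 'rV[R]_k) : 'M[R]_(n, m) :=
  col_mx 1%:M 0 + col_mx 0 1%:M *m C u.

(** After conjugation by [P] this is [[1; C] A [1; C]^T], whose left blocks are [A] and [C A] and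
    whose Schur complement vanishes when [A] is invertible. *)
Definition pfaffian_chart (u : 'rV[R]_k) : 'M[R]_n :=
  invmx P *m (frame_column u *m A u *m (frame_column u)^T) *m (invmx P)^T.

Definition pfaffian_chart_inv (X : 'M[R]_n) : 'rV[R]_k :=
  c (col_mx (H *m X *m H^T) (K *m X *m H^T *m invmx (H *m X *m H^T))).

Definition pfaffian_chart_domain : set 'rV[R]_k := [set u | A u \in unitmx].

Lemma frame_columnE u : frame_column u = col_mx 1%:M (C u).
Proof.
by rewrite /frame_column mul_col_mx mul0mx mul1mx add_col_mx addr0 add0r.
Qed.

Lemma conj_pfaffian_chart u : P *m pfaffian_chart u *m P^T =
  block_mx (A u) (A u *m (C u)^T) (C u *m A u) (C u *m A u *m (C u)^T).
Proof.
rewrite /pfaffian_chart !mulmxA mulmxV // mul1mx -!mulmxA -trmx_mul mulmxV //.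
rewrite trmx1 mulmx1 mulmxA frame_columnE tr_col_mx mul_col_mx mul_col_row.
by rewrite trmx1 !mul1mx !mulmx1 !mulmxA.
Qed.

Lemma pfaffian_chart_blocks u :
  H *m pfaffian_chart u *m H^T = A u /\
  K *m pfaffian_chart u *m H^T = C u *m A u.
Proof.
by have := conj_pfaffian_chart u; rewrite conj_col_mx => /eq_block_mx[].
Qed.

Lemma usubmx_frame_skew u : (A u)^T = - A u.
Proof. by have := lS u; rewrite mem_skew_frames => /eqP. Qed.

Lemma mxpoly_map_pfaffian_chart : mxpoly_map pfaffian_chart.
Proof.
have Lp : mxpoly_map frame_column.
  have -> : frame_column = cst (col_mx 1%:M 0) +
      (mulmx (col_mx 0 1%:M) \o dsubmx \o l) by [].
  apply: mxpoly_add; first exact: mxpoly_cst.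
  exact: (mxpoly_linear (mulmx (col_mx 0 1%:M) \o dsubmx \o l)).
(* Transposition is not a constructor of [mxpoly_map], so the transposed column is again written as
   a constant plus a linear map. *)
have LTp : mxpoly_map (fun u => (frame_column u)^T).
  have -> : (fun u => (frame_column u)^T) = cst (col_mx 1%:M 0)^T +
      (trmx \o mulmx (col_mx 0 1%:M) \o dsubmx \o l).
    by apply/funext => u; rewrite /frame_column linearD.
  apply: mxpoly_add; first exact: mxpoly_cst.
  exact: (mxpoly_linear (trmx \o mulmx (col_mx 0 1%:M) \o dsubmx \o l)).
have Ap : mxpoly_map (usubmx \o l) := mxpoly_linear (usubmx \o l).
exact: mxpoly_mul (mxpoly_mul (mxpoly_cst (invmx P))
  (mxpoly_mul (mxpoly_mul Lp Ap) LTp)) (mxpoly_cst (invmx P)^T).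
Qed.

Lemma open_pfaffian_chart_domain : open pfaffian_chart_domain.
Proof.
rewrite openE => u uU.
have cA := mxpoly_map_continuous (mxpoly_linear (usubmx \o l)).
exact: (near_unitmx uU (cA u)).
Qed.

Lemma pfaffian_chartK u :
  pfaffian_chart_domain u -> pfaffian_chart_inv (pfaffian_chart u) = u.
Proof.
move=> uU; have [HH KH] := pfaffian_chart_blocks u.
by rewrite /pfaffian_chart_inv KH HH mulmxK // vsubmxK lK.
Qed.

(** Let [v] be the vector of coefficients of a linear relation. The [(H, H)] block shows that the
    upper part of [l v] is zero; the [(K, H)] block then leaves its lower part times the invertible
    [A u], so [l v = 0]. *)
Lemma pfaffian_chart_immersion :
  immersion_on pfaffian_chart_domain pfaffian_chart.
Proof.
move=> u uU a a0 i.
have d j : is_derive u (delta_mx 0 j) pfaffian_chart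
    (pderiv j pfaffian_chart u).
  split=> //.
  have [_ + _] := mxpoly_map_smooth setT mxpoly_map_pfaffian_chart 1%N.
  exact.
have dl j : is_derive u (delta_mx 0 j) l (l (delta_mx 0 j)).
  exact: (is_derive_linear_mx l (is_derive_id u (delta_mx 0 j))).
pose v := \sum_j a j *: (delta_mx 0 j : 'rV[R]_k).
have sumE b (F : {linear 'M[R]_n -> 'M[R]_(b, m)}) (f : 'I_k -> 'M[R]_(b, m)) :
    (forall j, F (pderiv j pfaffian_chart u) = f j) -> \sum_j a j *: f j = 0.
  move=> Ff; rewrite -[RHS](linear0 F) -[in RHS]a0 linear_sum.
  by apply: eq_bigr => j _; rewrite linearZ Ff.
have dH j : H *m pderiv j pfaffian_chart u *m H^T = usubmx (l (delta_mx 0 j)).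
  apply: (@is_derive_near_unique _ _ _ _ _ u (delta_mx 0 j) _ _ _
    (is_derive_linear_mx (mulmxr H^T \o mulmx H) (d j))
    (is_derive_linear_mx usubmx (dl j))).
  by near=> y; exact: (pfaffian_chart_blocks y).1.
have dK j : K *m pderiv j pfaffian_chart u *m H^T =
    dsubmx (l (delta_mx 0 j)) *m A u + C u *m usubmx (l (delta_mx 0 j)).
  apply: (@is_derive_near_unique _ _ _ _ _ u (delta_mx 0 j) _ _ _
    (is_derive_linear_mx (mulmxr H^T \o mulmx K) (d j))
    (is_derive_mulmx (is_derive_linear_mx dsubmx (dl j))
                     (is_derive_linear_mx usubmx (dl j)))).
  by near=> y; exact: (pfaffian_chart_blocks y).2.
have sumF b (F : {linear 'M[R]_(n, m) -> 'M[R]_(b, m)}) :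
    \sum_j F (l (a j *: delta_mx 0 j)) = F (l v) by rewrite /v !linear_sum.
have uv : usubmx (l v) = 0.
  rewrite -(sumF _ usubmx) -[RHS](sumE _ (mulmxr H^T \o mulmx H) _ dH).
  by apply: eq_bigr => j _; rewrite !linearZ.
have dv : dsubmx (l v) = 0.
  have /= := sumE _ (mulmxr H^T \o mulmx K) _ dK.
  under eq_bigr do rewrite scalerDr scalemxAl scalemxAr -!linearZ /=.
  rewrite big_split /= -mulmx_suml -mulmx_sumr.
  rewrite (sumF _ dsubmx) (sumF _ usubmx) /= uv mulmx0.
  by rewrite addr0 => /(canRL (mulmxK uU)); rewrite mul0mx.
have v0 : v = 0 by rewrite -[v]lK -[l v]vsubmxK uv dv col_mx0 linear0.
have /rowP/(_ i) := v0; rewrite summxE mxE (bigD1 i) //= big1 => [|j ji].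
  by rewrite !mxE !eqxx mulr1 addr0.
by rewrite !mxE eq_sym (negPf ji) andbF mulr0.
Unshelve. all: by end_near. Qed.

Lemma pfaffian_chart_image : pfaffian_chart @` pfaffian_chart_domain =
  pfaffian_regular R n r `&` [set X | H *m X *m H^T \in unitmx].
Proof.
apply/seteqP; split=> [_ [u uU <-]|X [[[XT _] rX] XU]].
  have [HH _] := pfaffian_chart_blocks u.
  (* The chart factors through [m] columns, which bounds the rank above; its compression by [H] is
     the invertible [A u], which bounds it below. *)
  have rk : \rank (pfaffian_chart u) = m.
    apply/eqP; rewrite eqn_leq; apply/andP; split.
      rewrite /pfaffian_chart -!mulmxA mulmxA.
      by apply: leq_trans (mxrankM_maxl _ _) (rank_leq_col _).
    rewrite -[X in (X <= _)%N](mxrank_unit uU) -HH.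
    by apply: leq_trans (mxrankM_maxl _ _) (mxrankM_maxr _ _).
  split; last by rewrite /= HH.
  split=> //; split; last by rewrite rk.
  rewrite /Skew /= skewmxE /pfaffian_chart !trmx_mul !trmxK usubmx_frame_skew.
  by rewrite !(mulNmx, mulmxN) !mulmxA.
move: XT; rewrite /Skew /= skewmxE => /eqP XT.
have yS : K *m X *m K^T =
    K *m X *m H^T *m invmx (H *m X *m H^T) *m (H *m X *m K^T).
  apply: (schur_complement_eq0 XU); rewrite -conj_col_mx.
  by rewrite mxrank_conj_unit.
have AT : (H *m X *m H^T)^T = - (H *m X *m H^T).
  by rewrite !trmx_mul trmxK XT mulNmx mulmxN mulmxA.
set A0 := H *m X *m H^T in XU yS AT *.
have lE : l (pfaffian_chart_inv X) = col_mx A0 (K *m X *m H^T *m invmx A0).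
  by rewrite cK // mem_skew_frames col_mxKu AT.
exists (pfaffian_chart_inv X).
  by rewrite /pfaffian_chart_domain /= lE col_mxKu.
apply: (conj_unit_inj Pu); rewrite conj_pfaffian_chart conj_col_mx lE.
rewrite col_mxKu col_mxKd mulmxKV //.
(* Two signs cancel, one from the transpose of [invmx A0] and one from that of [X]; this recovers
   the upper right block. *)
have AC : A0 *m (K *m X *m H^T *m invmx A0)^T = H *m X *m K^T.
  rewrite trmx_mul trmx_inv mulmxA AT -[X in X *m _ *m _]opprK -AT mulNmx.
  rewrite mulmxV ?unitmx_tr // mulNmx mul1mx !trmx_mul trmxK XT mulNmx.
  by rewrite mulmxN opprK mulmxA.
by congr block_mx; rewrite // yS -AC mulmxA mulmxKV.
Qed.

Lemma compression_cvg b (E : 'M[R]_(b, n)) (X : 'M[R]_n) :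
  E *m Y *m H^T @[Y --> X] --> E *m X *m H^T.
Proof.
have idX : Y @[Y --> X] --> X by exact: cvg_id.
exact: (cvg_mulmx (cvg_mulmx (cvg_cst E) idX) (cvg_cst H^T)).
Qed.

Lemma open_unit_compression : open [set X : 'M[R]_n | H *m X *m H^T \in unitmx].
Proof.
rewrite openE => X XU; exact: (near_unitmx XU (@compression_cvg _ H X)).
Qed.

Lemma pfaffian_chart_inv_continuous (X : 'M[R]_n) : H *m X *m H^T \in unitmx ->
  pfaffian_chart_inv Y @[Y --> X] --> pfaffian_chart_inv X.
Proof.
move=> XU.
have cX b (E : 'M[R]_(b, n)) := @compression_cvg b E X.
(* Stacking is rewritten with products and a sum, so that the limit lemmas for these apply. *)
have colE (Y1 : 'M[R]_m) (Y2 : 'M[R]_(q, m)) :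
    col_mx Y1 Y2 = col_mx 1%:M 0 *m Y1 + col_mx 0 1%:M *m Y2.
  by rewrite !mul_col_mx !mul0mx !mul1mx add_col_mx addr0 add0r.
have cvgcol : col_mx (H *m Y *m H^T) (K *m Y *m H^T *m invmx (H *m Y *m H^T))
    @[Y --> X] -->
    col_mx (H *m X *m H^T) (K *m X *m H^T *m invmx (H *m X *m H^T)).
  rewrite colE; under eq_fun do rewrite colE.
  apply: cvgD; first exact: nbhs_filter.
    exact: (cvg_mulmx (cvg_cst (col_mx 1%:M 0 : 'M[R]_(n, m))) (cX _ H)).
  have cKH : K *m Y *m H^T *m invmx (H *m Y *m H^T) @[Y --> X] -->
      K *m X *m H^T *m invmx (H *m X *m H^T).
    exact: (cvg_mulmx (cX _ K) (cvg_invmx XU (cX _ H))).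
  exact: (cvg_mulmx (cvg_cst (col_mx 0 1%:M : 'M[R]_(n, q))) cKH).
exact: (cvg_linear_mx (L := c) cvgcol).
Qed.

Lemma pfaffian_chart_local_parametrization :
  local_parametrization (pfaffian_regular R n r) pfaffian_chart_domain
    pfaffian_chart.
Proof.
split.
- exact: open_pfaffian_chart_domain.
- exact: mxpoly_map_smooth mxpoly_map_pfaffian_chart.
- exact: pfaffian_chart_immersion.
- exists [set X | H *m X *m H^T \in unitmx], pfaffian_chart_inv; split.
  + exact: open_unit_compression.
  + exact: pfaffian_chart_image.
  + apply: continuous_in_subspaceT => X; rewrite inE => -[_ XU].
    exact: pfaffian_chart_inv_continuous.
  + exact: pfaffian_chartK.
Qed.

End Parametrization.

Lemma pfaffian_regular_submanifold (R : realType) (r q : nat) :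
  smooth_submanifold
    (\dim (skew_frames (2 * r) q : {vspace 'M[R]_(2 * r + q, 2 * r)}))
    (Skew R (2 * r + q)) (pfaffian_regular R (2 * r + q) r).
Proof.
split=> [X [[]] //|p pM].
have [[pS _] pr] := pM.
have pT : p^T = - p by move: pS; rewrite /Skew /= skewmxE => /eqP.
(* The splitting at [p] itself supplies the chart: [H p H^T] is invertible, so [p] lies in its
   image. *)
have [H [K [_ _ Au _ Pu]]] := skew_rank_splitting pT pr.
have [l [c [lS lK cK]]] := vspace_coordinates
  (skew_frames (2 * r) q : {vspace 'M[R]_(2 * r + q, 2 * r)}).
exists (pfaffian_chart_domain l), (pfaffian_chart l H K); split.
  exact: (pfaffian_chart_local_parametrization lS lK cK Pu).
by rewrite (pfaffian_chart_image lS cK Pu).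
Qed.

Theorem corollary4p6 (R : realType) (n r : nat) (hr : (r < n./2)%N) :
  minimal_submanifold (@skew_dot R n) (Skew R n) (pfaffian_regular R n r).
Proof.
(* The bound on [r] gives [2 * r <= n], which provides the block sizes [2 * r] and [q]. *)
have [q ->] : exists q, n = (2 * r + q)%N.
  by exists (n - 2 * r)%N; rewrite subnKC // mul2n -geq_half_double ltnW.
exists (\dim (skew_frames (2 * r) q : {vspace 'M[R]_(2 * r + q, 2 * r)})).
split; first exact: pfaffian_regular_submanifold.
by move=> U phi phiP u; exact: pfaffian_mean_curvature_eq0.
Qed.
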